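(* Let $\mathbf{n}=(n_0,\dots,n_d)$ with $n_i\ge 2$. Then $\tilde\beta_{d-1}(\mathcal{A}(f))=1$ for every centered colorful $\mathbf{n}$-configuration $f$ in relative general position.
   Context: Let $D_0,\dots,D_d$ be pairwise disjoint finite sets with $|D_i|=n_i$, $D=\bigcup_i D_i$, and let $\Delta(\mathbf{n})$ be the simplicial complex on $D$ whose faces are the $\sigma\subseteq D$ with $|\sigma\cap D_i|\le1$ for all $i$. A colorful $\mathbf{n}$-configuration is a map $f:D\to\mathbb{R}^d$; for $\sigma\in\Delta(\mathbf{n})$ set $f(\sigma)=\operatorname{conv}\{f(v):v\in\sigma\}$. It is centered if $0\in\operatorname{relint}\operatorname{conv} f(D_i)$ for all $i$, and in relative general position if $0\notin f(\tau)$ for every $\tau\in\Delta(\mathbf{n})$ with $|\tau|-1<d$. The avoiding complex is the subcomplex $\mathcal{A}(f)=\{\sigma\in\Delta(\mathbf{n}):0\notin f(\sigma)\}$. $\tilde\beta_k$ denotes the $k$-th reduced Betti number with $\mathbb{Z}_2$ coefficients. *)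

(* Defs.v *)
From HB Require Import structures.
From mathcomp Require Import all_boot all_order all_algebra.
From mathcomp Require Import all_classical all_reals all_analysis.
Set Implicit Arguments.
Unset Strict Implicit.
Unset Printing Implicit Defensive.
Import Order.TTheory GRing.Theory Num.Theory.
Import numFieldNormedType.Exports.

Local Open Scope classical_set_scope.
Local Open Scope ring_scope.

(* A simplicial complex on the finite vertex set V is a K : {set {set V}} that
   is closed under taking subsets; the empty set is a face (of dimension -1)
   as soon as K is nonempty, so that the homology below is the reduced one. *)
Definition down_closed (V : finType) (K : {set {set V}}) : Prop :=
  forall s t : {set V}, s \in K -> t \subset s -> t \in K.

Section Homology.
Variable V : finType.

Definition chain := {ffun {set V} -> ('F_2)^o}.

Definition simplex (s : {set V}) : chain := [ffun t => (t == s)%:R].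

Definition chains (K : {set {set V}}) (k : int) : {vspace chain} :=
  (\sum_(s in K | #|s|%:Z == (k + 1)%R) <[simplex s]>)%VS.

Definition boundary (c : chain) : chain :=
  \sum_(s : {set V}) c s *: (\sum_(v in s) simplex (s :\ v)%SET).

Lemma boundary_is_linear : linear boundary.
Proof.
move=> a b c; rewrite /boundary scaler_sumr -big_split; apply: eq_bigr => s _.
by rewrite /= !ffunE scalerDl scalerA.
Qed.

HB.instance Definition _ :=
  GRing.isLinear.Build 'F_2 chain chain *:%R boundary boundary_is_linear.

Definition cycles (K : {set {set V}}) (k : int) : {vspace chain} :=
  (chains K k :&: lker (linfun boundary))%VS.

Definition boundaries (K : {set {set V}}) (k : int) : {vspace chain} :=
  (linfun boundary @: chains K (k + 1)%R)%VS.

(* The truncated subtraction is the dimension of cycles / boundaries, by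
   [boundaries_sub_cycles]. *)
Definition reduced_betti (K : {set {set V}}) (k : int) : nat :=
  (\dim (cycles K k) - \dim (boundaries K k))%N.

Lemma boundary_simplex (s : {set V}) :
  boundary (simplex s) = \sum_(v in s) simplex (s :\ v)%SET.
Proof.
rewrite /boundary (bigD1 s) //= ffunE eqxx scale1r [X in _ + X]big1 ?addr0 // => t ts.
by rewrite ffunE (negPf ts) scale0r.
Qed.

Lemma boundary_boundary_simplex (s : {set V}) :
  boundary (boundary (simplex s)) = 0.
Proof.
rewrite boundary_simplex linear_sum /=.
under eq_bigr do rewrite boundary_simplex.
rewrite pair_big_dep /= (bigID (fun p => enum_rank p.1 < enum_rank p.2)%N) /=.
rewrite [X in _ + X](reindex_inj (inv_inj (@swap_pairK V V : involutive _))) /=.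
rewrite [X in _ + X](eq_big (fun p : V * V => (p.1 \in s) &&
    (p.2 \in (s :\ p.1)%SET) && (enum_rank p.1 < enum_rank p.2)%N)
    (fun p => simplex (s :\ p.1 :\ p.2)%SET)) /=.
- by rewrite -mulr2n -scaler_nat (_ : 2%:R = 0 :> 'F_2) ?scale0r //; apply/val_inj.
- move=> [v w] /=; rewrite !in_setD1 -leqNgt leq_eqVlt (inj_eq val_inj).
  by rewrite (inj_eq enum_rank_inj) eq_sym; case: (w =P v) => [->|];
    rewrite /= ?andbF //= ?(andbC (v \in s)).
- by move=> [v w] _ /=; congr simplex; apply/setP => u; rewrite !in_setD1 andbCA.
Qed.

Lemma boundaries_sub_cycles (K : {set {set V}}) (k : int) :
  down_closed K -> (boundaries K k <= cycles K k)%VS.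
Proof.
move=> Kdown; apply/subvP => _ /memv_imgP[c cK ->]; rewrite lfunE /=.
move: cK => /memv_sumP[x xK ->]; rewrite linear_sum; apply: memv_suml => s.
move=> /andP[sK /eqP sk]; have /vlineP[a ->] : x s \in <[simplex s]>%VS.
  by apply: xK; rewrite sK sk eqxx.
rewrite linearZ memvZ //= memv_cap memv_ker lfunE /= boundary_boundary_simplex.
rewrite eqxx andbT boundary_simplex; apply: memv_suml => v vs.
rewrite /chains; apply/subvP: (memv_line (simplex (s :\ v)%SET)).
apply: (sumv_sup (s :\ v)%SET); last exact: subvv.
rewrite (Kdown s) ?subD1set //=; apply/eqP.
by move: sk; rewrite (cardsD1 v) vs PoszD addrC => /addIr.
Qed.

End Homology.

Section Convexity.
Variables (R : realType) (d : nat).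
Implicit Types A : set 'rV[R]_d.

Definition aff A : set 'rV[R]_d :=
  [set x | exists (m : nat) (w : 'I_m -> R) (a : 'I_m -> 'rV[R]_d),
    [/\ forall j, A (a j), \sum_j w j = 1 & x = \sum_j w j *: a j]].

Definition conv A : set 'rV[R]_d :=
  [set x | exists (m : nat) (w : 'I_m -> R) (a : 'I_m -> 'rV[R]_d),
    [/\ forall j, A (a j), forall j, 0 <= w j, \sum_j w j = 1
      & x = \sum_j w j *: a j]].

(* [A] is a neighbourhood of x in the subspace topology of its affine hull. *)
Definition relint A : set 'rV[R]_d :=
  [set x | A x /\ within (aff A) (nbhs x) A].

Lemma conv_mono A B : A `<=` B -> conv A `<=` conv B.
Proof.
by move=> AB x [m [w [a [Aa w0 w1 ->]]]]; exists m, w, a; split=> // j; apply: AB.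
Qed.
End Convexity.

Section Configuration.
Variables (R : realType) (d : nat) (V : finType).
Variables (D : 'I_d.+1 -> {set V}) (f : V -> 'rV[R]_d).

Definition Delta : {set {set V}} :=
  [set s : {set V} | [forall i, #|s :&: D i| <= 1]%N]%SET.

Definition conv_image (s : {set V}) : set 'rV[R]_d := conv (f @` [set` s]).

Definition centered : Prop := forall i, relint (conv_image (D i)) 0.

(* #|t| <= d is the condition |t| - 1 < d, without truncated subtraction. *)
Definition relative_general_position : Prop :=
  forall t : {set V}, t \in Delta -> (#|t| <= d)%N -> ~ conv_image t 0.

Definition avoiding : {set {set V}} :=
  [set s in Delta | `[< ~ conv_image s 0 >] ]%SET.

Lemma avoiding_down_closed : down_closed avoiding.
Proof.
move=> s t; rewrite !inE => /andP[/forallP sD /asboolP s0] ts.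
apply/andP; split.
  by apply/forallP => i; apply: leq_trans (sD i); apply/subset_leq_card/finset.setSI.
apply/asboolP => t0; apply: s0; apply: conv_mono t0.
by apply: image_subset => v /=; apply: (fintype.subsetP ts).
Qed.
End Configuration.

(* Main.v *)
Require Import Defs.
From mathcomp Require Import all_boot all_order all_algebra.
From mathcomp Require Import all_classical all_reals all_analysis.
From mathcomp Require Import ring lra zify.
Set Implicit Arguments.
Unset Strict Implicit.
Unset Printing Implicit Defensive.
Import Order.TTheory GRing.Theory Num.Theory.
Import numFieldNormedType.Exports.
Local Open Scope ring_scope.

(* By Gordan's theorem a rainbow simplex avoids the origin iff it lies in an
   open half-space {x | x.u > 0}, so the avoiding complex is the union of the
   complexes A_u of rainbow simplices on the vertices with x.u > 0. Each A_u is
   a join of discrete sets, nonempty for every colour not contained in the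
   hyperplane normal to u because the configuration is centered, hence highly
   connected. For a convex cone C of normals let A_C be the union of the A_u
   with u in C. A hyperplane cuts C into two open parts and a section, and the
   two corresponding complexes cover A_C and meet in that of the section.
   Mayer-Vietoris, applied to the hyperplanes normal to the f v, shows that A_C
   is as connected as needed when C is pointed; applied to a complete flag of
   linear subspaces L, it then raises the single homology class of A_0, which
   is {set0}, one dimension at a time up to the whole space. *)

(** * Mayer-Vietoris arguments *)

Section Homology.
Variable V : finType.
Implicit Types (K : {set {set V}}) (s t : {set V}) (b c z : chain V) (m n : nat).

(* Indexing by the number n of vertices of a simplex, rather than by its
   dimension n - 1, keeps the index a natural number. *)
Definition nchains K n : {vspace chain V} := chains K (n%:Z - 1).

Lemma chain_sum c : c = \sum_s c s *: simplex s.
Proof.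
apply/ffunP => t; rewrite sum_ffunE (bigD1 t) //= big1 ?addr0.
  by rewrite !ffunE eqxx [RHS]mulr1.
by move=> s st; rewrite !ffunE eq_sym (negPf st) [LHS]mulr0.
Qed.

Lemma nchainsP K n c :
  reflect (forall s, c s != 0 -> s \in K /\ #|s| = n) (c \in nchains K n).
Proof.
apply: (iffP idP) => [/memv_sumP[x xK ->] s|cK].
  rewrite sum_ffunE => sn0.
  have [t tK xt] : exists2 t, (t \in K) && (#|t|%:Z == n%:Z - 1 + 1) & x t s != 0.
    apply/exists_inP; apply: contraNT sn0 => /exists_inPn x0.
    by apply/eqP; apply: big1 => t /x0 /negPn/eqP.
  have /vlineP[a xE] : x t \in <[simplex t]>%VS by exact: xK.
  move: xt tK; rewrite xE !ffunE; case: (s =P t) => [->|_].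
    by move=> _ /andP[-> /eqP]; rewrite subrK => -[].
  by rewrite [_ *: _]mulr0 eqxx.
rewrite (chain_sum c); apply: memv_suml => s _.
have [->|/cK[sK sn]] := eqVneq (c s) 0; first by rewrite scale0r mem0v.
apply: memvZ; apply: (subvP (sumv_sup s _ (subvv _))); last exact: memv_line.
by rewrite sK sn subrK eqxx.
Qed.

Lemma nchains_simplex K s : s \in K -> simplex s \in nchains K #|s|.
Proof.
move=> sK; apply/nchainsP => t; rewrite ffunE.
by case: (t =P s) => [->|_] //; rewrite eqxx.
Qed.

Lemma sub_nchains K1 K2 n : K1 \subset K2 -> (nchains K1 n <= nchains K2 n)%VS.
Proof.
move=> K12; apply/subvP => c /nchainsP cK; apply/nchainsP => s /cK[sK ->].
by split=> //; apply: (fintype.subsetP K12).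
Qed.

Lemma nchains_setI K1 K2 n c : c \in nchains K1 n -> c \in nchains K2 n ->
  c \in nchains (K1 :&: K2) n.
Proof.
move=> /nchainsP c1 /nchainsP c2; apply/nchainsP => s cs.
by have [s1 ->] := c1 _ cs; have [s2 _] := c2 _ cs; rewrite inE s1 s2.
Qed.

Lemma nchains_setU K1 K2 n c : c \in nchains (K1 :|: K2) n ->
  exists c1 c2, [/\ c1 \in nchains K1 n, c2 \in nchains K2 n & c = c1 + c2].
Proof.
move=> /nchainsP cK.
exists [ffun s => if s \in K1 then c s else 0].
exists [ffun s => if s \in K1 then 0 else c s]; split.
- apply/nchainsP => s; rewrite ffunE; case: ifP; last by rewrite eqxx.
  by move=> sK /cK[].
- apply/nchainsP => s; rewrite ffunE; case: ifP; first by rewrite eqxx.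
  by move=> sK /cK[]; rewrite inE sK.
- by apply/ffunP => s; rewrite !ffunE; case: ifP; rewrite ?addr0 ?add0r.
Qed.

Lemma boundary_nchains K n c :
  down_closed K -> c \in nchains K n.+1 -> boundary c \in nchains K n.
Proof.
move=> Kdown /nchainsP cK; rewrite /boundary; apply: memv_suml => s _.
have [->|/cK[sK sn]] := eqVneq (c s) 0; first by rewrite scale0r mem0v.
apply/memvZ/memv_suml => v vs; rewrite (_ : n = #|s :\ v|); last first.
  by move: sn; rewrite (cardsD1 v) vs => -[].
by apply/nchains_simplex/(Kdown s) => //; apply: subD1set.
Qed.

Lemma boundary_sum c : boundary c = \sum_s c s *: boundary (simplex s).
Proof.
by rewrite {1}(chain_sum c) linear_sum; apply: eq_bigr => s _; rewrite linearZ.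
Qed.

Lemma boundary_boundary c : boundary (boundary c) = 0.
Proof.
rewrite [boundary c]boundary_sum linear_sum big1 // => s _.
by rewrite linearZ /= boundary_boundary_simplex scaler0.
Qed.

Lemma boundary_nchains0 K c : c \in nchains K 0 -> boundary c = 0.
Proof.
move=> /nchainsP cK; rewrite /boundary big1 // => s _.
have [->|/cK[_ /cards0_eq ->]] := eqVneq (c s) 0; first by rewrite scale0r.
by rewrite big1 ?scaler0 // => v; rewrite inE.
Qed.

(** With vertices counted, this is vanishing of reduced homology in all dimensions up to [m - 2]. *)
Definition acyclic_lt K m := forall n, (n < m)%N ->
  forall z, z \in nchains K n -> boundary z = 0 ->
  exists2 b, b \in nchains K n.+1 & boundary b = z.

(** Reduced homology in dimension [n - 1] is a line. Naming a generating cycle avoids quotient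
    spaces in the gluing arguments. *)
Definition homology_line K n := exists z0,
  [/\ z0 \in nchains K n, boundary z0 = 0,
      forall b, b \in nchains K n.+1 -> boundary b <> z0
    & forall z, z \in nchains K n -> boundary z = 0 ->
      exists a, exists2 b, b \in nchains K n.+1 & z = a *: z0 + boundary b].

Lemma acyclic_lt_leq K m m' : (m' <= m)%N -> acyclic_lt K m -> acyclic_lt K m'.
Proof. by move=> m'm Km n nm'; apply: Km; apply: leq_trans m'm. Qed.

Lemma homology_line_not_acyclic K n : homology_line K n -> ~ acyclic_lt K n.+1.
Proof.
move=> [z0 [z0K z0B z0nB _]] /(_ n (leqnn _) z0 z0K z0B)[b bK].
exact: z0nB.
Qed.

(** A cycle of the union splits as [z1 + z2], and the boundary of [z1] is a cycle of the
    intersection. Filling it there by [w] turns [z1 - w] and [z2 + w] into cycles of the two pieces.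
    The intersection enters one degree lower, hence [m.-1]. *)
Lemma acyclic_ltU K1 K2 m : down_closed K1 -> down_closed K2 ->
  acyclic_lt K1 m -> acyclic_lt K2 m -> acyclic_lt (K1 :&: K2) m.-1 ->
  acyclic_lt (K1 :|: K2) m.
Proof.
move=> K1d K2d K1m K2m K0m n nm z /nchains_setU[z1 [z2 [z1K z2K ->]]] zB.
have [w [w1 w2 wE]] : exists w, [/\ w \in nchains K1 n, w \in nchains K2 n
    & boundary w = boundary z1].
  case: n nm z1K z2K zB => [|n] nm z1K z2K zB.
    (* In degree zero [z1] lives on the empty face, so its boundary is 0 and [w = 0] serves. *)
    by exists 0; rewrite !mem0v (boundary_nchains0 z1K) linear0.
  have z12 : boundary z1 = - boundary z2 by apply/eqP; rewrite -addr_eq0 -zB linearD.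
  have [|||w wK wE] := K0m n _ (boundary z1).
  - by case: m nm {K1m K2m K0m}.
  - apply: nchains_setI; first exact: boundary_nchains.
    by rewrite z12 memvN; apply: boundary_nchains.
  - exact: boundary_boundary.
  exists w; split; last exact: wE.
    by apply: subvP wK; rewrite sub_nchains ?subsetIl.
  by apply: subvP wK; rewrite sub_nchains ?subsetIr.
have [||b1 b1K b1E] := K1m n nm (z1 - w); first exact: memvB.
  by rewrite linearB /= wE subrr.
have [||b2 b2K b2E] := K2m n nm (z2 + w); first exact: memvD.
  by rewrite linearD /= wE addrC -zB linearD.
exists (b1 + b2); last by rewrite linearD /= b1E b2E addrACA addNr addr0.
by apply: memvD; [apply: subvP b1K|apply: subvP b2K];
  rewrite sub_nchains ?finset.subsetUl ?finset.subsetUr.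
Qed.

(** As in a suspension, the new generator is the difference [a1 - a2] of two fillings of [z0], one
    in each piece. *)
Lemma homology_lineU K1 K2 n : down_closed K1 -> down_closed K2 ->
  acyclic_lt K1 n.+2 -> acyclic_lt K2 n.+2 -> homology_line (K1 :&: K2) n ->
  homology_line (K1 :|: K2) n.+1.
Proof.
move=> K1d K2d K1n K2n [z0 [z0K z0B z0nB z0gen]].
have K01 k : (nchains (K1 :&: K2) k <= nchains K1 k)%VS by rewrite sub_nchains ?subsetIl.
have K02 k : (nchains (K1 :&: K2) k <= nchains K2 k)%VS by rewrite sub_nchains ?subsetIr.
have K1U k : (nchains K1 k <= nchains (K1 :|: K2) k)%VS.
  by rewrite sub_nchains ?finset.subsetUl.
have K2U k : (nchains K2 k <= nchains (K1 :|: K2) k)%VS.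
  by rewrite sub_nchains ?finset.subsetUr.
have [||a1 a1K a1E] := K1n n (leqW (leqnn _)) z0 => //; first exact: subvP z0K.
have [||a2 a2K a2E] := K2n n (leqW (leqnn _)) z0 => //; first exact: subvP z0K.
exists (a1 - a2); split.
- by apply: memvB; [apply: subvP a1K|apply: subvP a2K].
- by rewrite linearB /= a1E a2E subrr.
- move=> _ /nchains_setU[b1 [b2 [b1K b2K ->]]] bE.
  have xE : a1 - boundary b1 = a2 + boundary b2.
    have swap (M : zmodType) (x x' y y' : M) : x - x' = y + y' -> x - y = x' + y'.
      by move=> /eqP; rewrite subr_eq => /eqP ->; rewrite addrAC [y + y']addrC addrK addrC.
    by apply: swap; rewrite -bE linearD.
  (* This chain lies in both pieces and would fill [z0] inside the intersection. *)
  apply: (z0nB (a1 - boundary b1)).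
    apply: nchains_setI; last rewrite xE;
    by rewrite ?memvB ?memvD // boundary_nchains.
  by rewrite linearB /= boundary_boundary subr0.
- move=> _ /nchains_setU[z1 [z2 [z1K z2K ->]]] zB.
  have z12 : boundary z1 = - boundary z2 by apply/eqP; rewrite -addr_eq0 -zB linearD.
  (* The class of [boundary z1] in the intersection gives the coefficient [a]. Removing [a] times
     [a1 - a2], and shifting by [w], leaves a cycle on each side. *)
  have [||a [w wK wE]] := z0gen (boundary z1).
  + apply: nchains_setI; first exact: boundary_nchains.
    by rewrite z12 memvN; apply: boundary_nchains.
  + exact: boundary_boundary.
  have [||p1 p1K p1E] := K1n n.+1 (leqnn _) (z1 - a *: a1 - w).
  + by rewrite !memvB ?memvZ //; apply: subvP wK.
  + by rewrite !linearB linearZ /= wE a1E [_ + boundary w]addrC addrK subrr.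
  have [||p2 p2K p2E] := K2n n.+1 (leqnn _) (z2 + a *: a2 + w).
  + by rewrite !memvD ?memvZ //; apply: subvP wK.
  + by rewrite !linearD linearZ /= a2E -addrA -wE z12 subrr.
  exists a; exists (p1 + p2).
    by apply: memvD; [apply: subvP p1K|apply: subvP p2K].
  rewrite [boundary _]linearD /= p1E p2E scalerBr.
  rewrite [_ + (z2 + _ + w)]addrACA addNr addr0 [z1 - _ + _]addrACA addrCA.
  by rewrite [a *: a1 - _ + _]addrACA subrr add0r [_ + a *: a2]addrC addKr.
Qed.

Lemma homology_line_betti K n : down_closed K ->
  homology_line K n -> reduced_betti K (n%:Z - 1) = 1%N.
Proof.
move=> Kd [z0 [z0K z0B z0nB z0gen]].
have BE : boundaries K (n%:Z - 1) = (linfun (@boundary V) @: nchains K n.+1)%VS.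
  rewrite /boundaries /nchains (_ : n%:Z - 1 + 1 = n.+1%:Z - 1) //.
  by rewrite -[n.+1]addn1 PoszD addrAC.
rewrite /reduced_betti; have -> : cycles K (n%:Z - 1) = (boundaries K (n%:Z - 1) + <[z0]>)%VS.
  apply/eqP; rewrite eqEsubv; apply/andP; split.
    apply/subvP => z; rewrite memv_cap memv_ker lfunE => /andP[zK /eqP zB].
    have [a [b bK ->]] := z0gen z zK zB.
    rewrite addrC memv_add ?memvZ ?memv_line // BE.
    by rewrite -[boundary b]lfunE memv_img.
  rewrite subv_add boundaries_sub_cycles //= -memvE memv_cap memv_ker lfunE /=.
  by rewrite z0B eqxx andbT.
(* No nonzero multiple of [z0] is a boundary, so the sum is direct. *)
rewrite dimv_disjoint_sum; last first.
  apply/eqP; rewrite -subv0; apply/subvP => x; rewrite memv_cap.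
  move=> /andP[xB /vlineP[a xE]]; move: xB; rewrite xE.
  have [->|a0] := eqVneq a 0; first by rewrite scale0r memv0.
  move=> /(memvZ a^-1); rewrite scalerA mulVf // scale1r BE => /memv_imgP[b bK].
  by rewrite lfunE => /esym /(z0nB _ bK).
rewrite dim_vline addKn; case: eqP => // z00.
by case: (z0nB 0 (mem0v _)); rewrite linear0.
Qed.

(** Adjoining [v] to simplices is a contracting homotopy [h]: the boundary of [h z] plus [h] of the
    boundary of [z] is [z], so [h z] fills a cycle [z]. *)
Lemma acyclic_cone K v m :
  (forall s, s \in K -> (v |: s)%SET \in K) -> acyclic_lt K m.
Proof.
move=> Kv n _ z zK zB.
pose h c : chain V := \sum_(s : {set V} | v \notin s) c s *: simplex (v |: s)%SET.
have hD c c' : h (c + c') = h c + h c'.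
  by rewrite -big_split; apply: eq_bigr => s _; rewrite ffunE scalerDl.
have hZ a c : h (a *: c) = a *: h c.
  by rewrite scaler_sumr; apply: eq_bigr => s _; rewrite ffunE scalerA.
have h0 : h 0 = 0 by rewrite /h big1 // => s _; rewrite ffunE scale0r.
have hsum (T : finType) (P : pred T) (F : T -> chain V) :
    h (\sum_(i | P i) F i) = \sum_(i | P i) h (F i) by exact: (big_morph h hD h0).
have hs s : h (simplex s) = if v \in s then 0 else simplex (v |: s)%SET.
  rewrite /h; case: ifP => vs.
    rewrite big1 // => t vt; rewrite ffunE; case: eqP => [tE|]; last by rewrite scale0r.
    by rewrite tE vs in vt.
  rewrite (bigD1 s) ?vs //= ffunE eqxx scale1r big1 ?addr0 // => t /andP[_ ts].
  by rewrite ffunE (negPf ts) scale0r.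
have hzK : h z \in nchains K n.+1.
  apply: memv_suml => s vs; have [->|] := eqVneq (z s) 0; first by rewrite scale0r mem0v.
  move=> /(elimT (nchainsP _ _ _) zK)[sK <-]; apply: memvZ.
  by rewrite -[#|s|.+1]/(true + #|s|)%N -vs -cardsU1; apply/nchains_simplex/Kv.
clearbody h.
have homotopy_simplex s : boundary (h (simplex s)) + h (boundary (simplex s)) = simplex s.
  rewrite hs boundary_simplex hsum; case: ifP => vs.
    rewrite linear0 add0r (bigD1 v) //= hs !inE eqxx /= finset.setD1K // big1 ?addr0 //.
    by move=> w /andP[_ wv]; rewrite hs !inE vs eq_sym wv.
  rewrite boundary_simplex (bigD1 v) ?setU11 //= finset.setU1K ?vs // -addrA.
  rewrite [X in _ + X](_ : _ = 0) ?addr0 //.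
  rewrite (eq_big (fun w => w \in s) (fun w => simplex (v |: s :\ w)%SET)).
  (* The two sums have the same terms and cancel in characteristic two. *)
  - rewrite -big_split big1 // => w ws /=; rewrite hs !inE vs andbF.
    by rewrite -mulr2n -scaler_nat (_ : 2%:R = 0 :> 'F_2) ?scale0r //; apply/val_inj.
  - by move=> w; rewrite !inE; case: (w =P v) => [->|]; rewrite ?vs ?andbT ?andbF.
  - move=> w /andP[_ wv]; congr simplex; apply/setP => u; rewrite !inE.
    by case: (u =P v) => [->|]; rewrite ?(eq_sym v) ?wv ?andbT //= andbC.
exists (h z); first exact: hzK.
have hzE : h z = \sum_s z s *: h (simplex s).
  by rewrite {1}(chain_sum z) hsum; apply: eq_bigr => s _; rewrite hZ.
have: boundary (h z) + h (boundary z) = z.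
  rewrite [boundary z]boundary_sum hsum hzE linear_sum -big_split [RHS]chain_sum.
  apply: eq_bigr => s _ /=.
  by rewrite linearZ /= hZ -scalerDr homotopy_simplex.
by rewrite zB h0 addr0.
Qed.

(** This complex plays the role of the sphere of dimension -1. *)
Lemma homology_line_empty : homology_line [set finset.set0]%SET 0.
Proof.
exists (simplex finset.set0); split.
- by have /nchains_simplex := finset.set11 (@finset.set0 V); rewrite cards0.
- by rewrite boundary_simplex big1 // => v; rewrite inE.
- move=> b /nchainsP bK; have -> : b = 0.
    apply/ffunP => s; rewrite ffunE; apply/eqP; apply/negPn/negP => /bK[].
    by rewrite inE => /eqP ->; rewrite cards0.
  by rewrite linear0 => /ffunP/(_ finset.set0); rewrite !ffunE eqxx.
- move=> z /nchainsP zK _; exists (z finset.set0), 0; first exact: mem0v.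
  rewrite linear0 addr0; apply/ffunP => s; rewrite !ffunE.
  case: (s =P finset.set0) => [->|s0]; first by rewrite [RHS]mulr1.
  rewrite [RHS]mulr0; apply/eqP/negPn/negP => /zK[].
  by rewrite inE => /eqP.
Qed.

End Homology.

(** * Joins of discrete sets *)

Section Rainbow.
Variables (V I : finType) (col : V -> I).
Implicit Types (Q s : {set V}).

(** This is the join of the discrete colour classes of [Q]; comparing cardinalities is a decidable
    form of injectivity of [col] on [s]. *)
Definition rainbow Q : {set {set V}} :=
  [set s : {set V} | (s \subset Q) && (#|col @: s| == #|s|)]%SET.

Lemma rainbowP Q s :
  reflect (s \subset Q /\ {in s &, injective col}) (s \in rainbow Q).
Proof.
rewrite inE; apply: (iffP andP) => -[sQ sI]; split=> //; exact/imset_injP.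
Qed.

Lemma rainbow_down_closed Q : down_closed (rainbow Q).
Proof.
move=> s t /rainbowP[sQ sI] ts; apply/rainbowP; split; first exact: fintype.subset_trans sQ.
by move=> x y xt yt; apply: sI; apply: (fintype.subsetP ts).
Qed.

Lemma rainbowI Q1 Q2 : rainbow Q1 :&: rainbow Q2 = rainbow (Q1 :&: Q2).
Proof.
by apply/setP => s; rewrite !inE finset.subsetI; case: (_ \subset _); case: eqP; rewrite ?andbF.
Qed.

(** Induction on [#|Q|]. If [v] is alone in its colour, the complex is a cone with apex [v].
    Otherwise the rest keeps all colours, and [v] is attached to it as a cone over the join of the
    other colours, which has one factor fewer. *)
Lemma acyclic_rainbow Q : acyclic_lt (rainbow Q) #|col @: Q|.
Proof.
have [k] := ubnP #|Q|; elim: k Q => // k IH Q /ltnSE Qk.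
have [->|[v vQ]] := set_0Vmem Q; first by rewrite imset0 cards0.
pose Qv := [set w in Q | col w != col v]%SET.
have cone : acyclic_lt (rainbow (v |: Qv)) #|col @: Q|.
  apply: (@acyclic_cone _ _ v) => s /rainbowP[sQ sI]; apply/rainbowP; split.
    by rewrite finset.subUset finset.sub1set setU11.
  have sv w : w \in s -> w <> v -> col w <> col v.
    by move=> /(fintype.subsetP sQ); rewrite !inE => /orP[/eqP|/andP[_ /eqP]].
  move=> x y /setU1P[->|xs] /setU1P[->|ys] xy //.
  - by apply/esym/eqP; apply: contraPT (esym xy) => /eqP; apply: sv.
  - by apply/eqP; apply: contraPT xy => /eqP; apply: sv.
  - exact: sI.
have QvS : v |: Qv \subset Q.
  by rewrite finset.subUset finset.sub1set vQ; apply/fintype.subsetP => w; rewrite inE => /andP[].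
have [QE|QN] := eqVneq (v |: Qv) Q; first by rewrite -{1}QE.
have [w [wQ wv wc]] : exists w, [/\ w \in Q, w != v & col w = col v].
  have /subsetPn[w wQ] : ~~ (Q \subset v |: Qv) by move: QN; rewrite finset.eqEsubset QvS.
  by rewrite !inE wQ negb_or negbK => /andP[wv /eqP wc]; exists w.
have -> : rainbow Q = rainbow (Q :\ v) :|: rainbow (v |: Qv).
  apply/setP => s; apply/idP/setUP => [/rainbowP[sQ sI]|[]].
  - have [vs|vs] := boolP (v \in s); [right|left]; apply/rainbowP; split=> //.
      apply/fintype.subsetP => x xs; rewrite !inE (fintype.subsetP sQ) //=.
      by case: (x =P v) => //= xv; apply/eqP => /sI; apply: contra_not xv; apply.
    by rewrite subsetD1 sQ.
  - move=> /rainbowP[sQ sI]; apply/rainbowP; split=> //.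
    exact: fintype.subset_trans sQ (subD1set _ _).
  - by move=> /rainbowP[sQ sI]; apply/rainbowP; split=> //; apply: fintype.subset_trans sQ _.
apply: acyclic_ltU => //; try exact: rainbow_down_closed.
- have -> : col @: Q = col @: (Q :\ v).
    apply/setP => i; apply/imsetP/imsetP => -[x xQ ->]; last first.
      by exists x => //; move: xQ; rewrite !inE => /andP[].
    have [->|xv] := eqVneq x v; last by exists x; rewrite // !inE xv.
    by exists w; rewrite // !inE wv.
  by apply: IH; move: Qk; rewrite (cardsD1 v) vQ.
- have -> : rainbow (Q :\ v) :&: rainbow (v |: Qv) = rainbow Qv.
    rewrite rainbowI; congr rainbow; apply/setP => x; rewrite !inE.
    by case: (x =P v) => [->|] /=; rewrite ?eqxx ?andbF //; case: (x \in Q).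
  have -> : #|col @: Q|.-1 = #|col @: Qv|.
    rewrite (cardsD1 (col v)) imset_f //=; congr #|pred_of_set _|.
    apply/setP => i; apply/setD1P/imsetP => [[iv /imsetP[x xQ iE]]|[x]].
      by exists x; rewrite // inE xQ -iE.
    by rewrite inE => /andP[xQ xv] ->; split=> //; apply: imset_f.
  apply: IH; apply: leq_trans Qk; apply: proper_card; apply/properP; split.
    by apply/fintype.subsetP => x; rewrite inE => /andP[].
  by exists v => //; rewrite inE eqxx andbF.
Qed.

End Rainbow.

(** * Cones of normal vectors *)

Section Dot.
Variables (R : realFieldType) (d : nat).
Implicit Types (x u w : 'rV[R]_d) (a : R) (L : {vspace 'rV[R]_d}).

Definition dot x u : R := (u *m x^T) 0 0.

Lemma dotC x u : dot x u = dot u x.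
Proof. by rewrite /dot -[x in RHS]trmxK -trmx_mul [RHS]mxE. Qed.

Lemma dotDr x u w : dot x (u + w) = dot x u + dot x w.
Proof. by rewrite /dot mulmxDl mxE. Qed.

Lemma dotZr x a u : dot x (a *: u) = a * dot x u.
Proof. by rewrite /dot -scalemxAl mxE. Qed.

Lemma dotDl x w u : dot (x + w) u = dot x u + dot w u.
Proof. by rewrite dotC dotDr !(dotC u). Qed.

Lemma dotZl a x u : dot (a *: x) u = a * dot x u.
Proof. by rewrite dotC dotZr (dotC u). Qed.

Lemma dotNl x u : dot (- x) u = - dot x u.
Proof. by rewrite -scaleN1r dotZl mulN1r. Qed.

Lemma dotNr x u : dot x (- u) = - dot x u.
Proof. by rewrite dotC dotNl dotC. Qed.

Lemma dot0l u : dot 0 u = 0.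
Proof. by rewrite -(scale0r (0 : 'rV[R]_d)) dotZl mul0r. Qed.

Lemma dot0r x : dot x 0 = 0.
Proof. by rewrite dotC dot0l. Qed.

Lemma dot_suml (T : Type) (r : seq T) (P : pred T) (F : T -> 'rV[R]_d) u :
  dot (\sum_(i <- r | P i) F i) u = \sum_(i <- r | P i) dot (F i) u.
Proof. by apply: (big_morph (dot^~ u)) => [x w|]; rewrite ?dotDl ?dot0l. Qed.

Lemma dot_self_gt0 x : (0 < dot x x) = (x != 0).
Proof.
have dE : dot x x = \sum_j x 0 j ^+ 2.
  by rewrite /dot mxE; apply: eq_bigr => j _; rewrite mxE.
rewrite lt_def dE sumr_ge0 ?andbT; last by move=> j _; apply: sqr_ge0.
congr (~~ _); apply/eqP/eqP => [x0|->]; last first.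
  by rewrite big1 // => j _; rewrite mxE expr0n.
apply/rowP => j; rewrite mxE; apply/eqP; rewrite -sqrf_eq0; apply/eqP.
by apply: (psumr_eq0P _ x0) => // i _; apply: sqr_ge0.
Qed.

Definition perp x : {vspace 'rV[R]_d} := lker (linfun (mulmxr x^T : 'rV[R]_d -> 'rV[R]_1)).

Lemma mem_perp x u : (u \in perp x) = (dot x u == 0).
Proof.
rewrite memv_ker lfunE /=; apply/eqP/eqP => [u0|xu]; first by rewrite /dot u0 mxE.
by apply/rowP => j; rewrite ord1 [RHS]mxE; exact: xu.
Qed.

Lemma dim_cap_perp L x : (\dim L <= (\dim (L :&: perp x)).+1)%N.
Proof.
have := limg_ker_dim (linfun (mulmxr x^T : 'rV[R]_d -> 'rV[R]_1)) L.
have : (\dim (linfun (mulmxr x^T : 'rV[R]_d -> 'rV[R]_1) @: L) <= 1)%N.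
  by apply: leq_trans (dimvS (subvf _)) _; rewrite dimvf.
by move=> le1 <-; rewrite -[X in (_ <= X)%N]addn1 leq_add2l.
Qed.

Lemma dim_cap_perp_self L x : x \in L -> x != 0 -> (\dim L = (\dim (L :&: perp x)).+1)%N.
Proof.
move=> xL x0; apply/eqP; rewrite eqn_leq dim_cap_perp /= ltnNge; apply/negP => Lx.
have /eqP LE : (L :&: perp x)%VS == L by rewrite eqEdim capvSl.
by move: xL; rewrite -LE memv_cap mem_perp => /andP[_ /eqP]; move: x0; rewrite -dot_self_gt0; lra.
Qed.

Lemma not_sub_perp L x : ~~ (L <= perp x)%VS -> exists2 w, w \in L & 0 < dot x w.
Proof.
move=> /subvPn[w wL]; rewrite mem_perp neq_lt => /orP[xw|xw]; last by exists w.
by exists (- w); [rewrite memvN|rewrite dotNr; lra].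
Qed.

Lemma small_perturbation (T : eqType) (r : seq T) (p q : T -> R) :
  (forall t, t \in r -> 0 < p t) ->
  exists2 e, 0 < e & forall t, t \in r -> 0 < p t + e * q t.
Proof.
move=> pr.
(* Asking for every smaller [e'] as well lets the induction take a minimum. *)
suff [e e0 er] : exists2 e, 0 < e &
    forall e', 0 < e' <= e -> forall t, t \in r -> 0 < p t + e' * q t.
  by exists e => // x; apply: er; rewrite e0 lexx.
elim: r pr => [|y r IH] pr; first by exists 1.
have [|e e0 er] := IH; first by move=> x xr; apply: pr; rewrite inE xr orbT.
have py : 0 < p y by apply: pr; rewrite inE eqxx.
have q1 : 0 < `|q y| + 1 by rewrite ltr_wpDl.
(* The added 1 keeps the denominator positive and makes the final inequality strict. *)
exists (Num.min e (p y / (`|q y| + 1))); first by rewrite lt_min e0 divr_gt0.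
move=> e' /andP[e'0]; rewrite le_min => /andP[e'e]; rewrite ler_pdivlMr // => e'y x.
rewrite inE => /orP[/eqP ->|xr]; last by apply: er; rewrite ?e'0.
have := ler_norm (- q y); rewrite normrN => qy.
have : e' * (- q y) <= e' * `|q y| by rewrite ler_pM2l.
by move: e'y; rewrite mulrDr mulr1 mulrN; lra.
Qed.

End Dot.

(** * Complexes of simplices lying in half-spaces with normals in a cone *)

Section Cells.
Variables (R : realFieldType) (d : nat) (V I : finType) (col : V -> I).
Variables (J : {set I}) (f : V -> 'rV[R]_d).
Implicit Types (G : seq 'rV[R]_d) (u w e : 'rV[R]_d) (s : {set V}).
Implicit Types (L : {vspace 'rV[R]_d}) (r : seq V).

Definition positive G u := all (fun g => 0 < dot g u) G.

(* The simplices lying in some open half-space whose inner normal belongs to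
   the cone { u in L | dot g u > 0 for all g in G }. *)
Definition cell_complex L G : {set {set V}} :=
  [set s in rainbow col (col @^-1: J) |
    `[< exists2 u, u \in L & positive G u /\ forall v, v \in s -> 0 < dot (f v) u >]]%SET.

Lemma cell_complexP L G s :
  reflect (s \in rainbow col (col @^-1: J) /\
    exists2 u, u \in L & positive G u /\ forall v, v \in s -> 0 < dot (f v) u)
    (s \in cell_complex L G).
Proof. by apply: (iffP setIdP) => -[? /asboolP]. Qed.

Lemma cell_complex_down_closed L G : down_closed (cell_complex L G).
Proof.
move=> s t /cell_complexP[sK [u uL [uG us]]] ts; apply/cell_complexP; split.
  exact: rainbow_down_closed sK ts.
by exists u => //; split=> // v vt; apply/us/(fintype.subsetP ts).
Qed.

Lemma positive_perturb G u w : positive G u ->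
  exists2 a, 0 < a & positive G (u + a *: w).
Proof.
move=> /allP uG; have [a a0 aG] := small_perturbation (fun g => dot g w) uG.
by exists a => //; apply/allP => g gG; rewrite dotDr dotZr; apply: aG.
Qed.

Lemma positiveD G a b u w : 0 < a -> 0 < b -> positive G u -> positive G w ->
  positive G (a *: u + b *: w).
Proof.
move=> a0 b0 /allP uG /allP wG; apply/allP => g gG.
by rewrite dotDr !dotZr addr_gt0 // mulr_gt0 ?uG ?wG.
Qed.

Lemma positive_cat G G' u : positive (G ++ G') u = positive G u && positive G' u.
Proof. exact: all_cat. Qed.

Lemma positive_map s u : reflect (forall v, v \in s -> 0 < dot (f v) u)
  (positive [seq f v | v <- enum s] u).
Proof.
rewrite /positive all_map; apply: (iffP allP) => su v; first by rewrite -mem_enum; apply: su.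
by rewrite mem_enum; apply: su.
Qed.

Lemma cell_complex_perturb L G u w s : u \in L -> w \in L -> positive G u ->
  (forall v, v \in s -> 0 < dot (f v) u) ->
  exists a, [/\ 0 < a, u + a *: w \in L, positive G (u + a *: w)
    & forall v, v \in s -> 0 < dot (f v) (u + a *: w)].
Proof.
move=> uL wL uG /positive_map us.
have [|a a0] := @positive_perturb (G ++ [seq f v | v <- enum s]) u w.
  by rewrite positive_cat uG.
rewrite positive_cat => /andP[aG /positive_map as_].
by exists a; split; rewrite // memvD ?memvZ.
Qed.

(** A normal orthogonal to [e] can be tilted off that hyperplane along [w], since finitely many
    strict inequalities survive a small perturbation. *)
Lemma cell_complexU L G e : ~~ (L <= perp e)%VS ->
  cell_complex L G = cell_complex L (e :: G) :|: cell_complex L (- e :: G).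
Proof.
move=> /not_sub_perp[w wL ew].
apply/setP => s; apply/idP/setUP; last first.
  by case=> /cell_complexP[sK [u uL [/andP[_ uG] us]]]; apply/cell_complexP; split=> //; exists u.
move=> /cell_complexP[sK [u uL [uG us]]].
have [eu|eu|eu] := ltgtP (dot e u) 0.
- right; apply/cell_complexP; split=> //; exists u; rewrite //= dotNl uG andbT.
  by split=> //; lra.
- by left; apply/cell_complexP; split=> //; exists u; rewrite //= uG eu.
- have [a [a0 uaL uaG uas]] := cell_complex_perturb uL wL uG us.
  left; apply/cell_complexP; split=> //; exists (u + a *: w); rewrite //= uaG dotDr dotZr eu.
  by rewrite add0r mulr_gt0.
Qed.

Lemma cell_complexI L G e : ~~ (L <= perp e)%VS ->
  cell_complex L (e :: G) :&: cell_complex L (- e :: G) = cell_complex (L :&: perp e) G.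
Proof.
move=> /not_sub_perp[w wL ew].
apply/setP => s; apply/setIP/cell_complexP.
  move=> [/cell_complexP[sK [u uL [/andP[eu uG] /positive_map us]]]].
  move=> /cell_complexP[_ [t tL [/andP[et tG] /positive_map ts]]]; rewrite dotNl in et.
  (* Up to a positive factor, this is the point where the segment from [u] to [t] crosses the
     hyperplane orthogonal to [e]. *)
  split=> //; exists (- dot e t *: u + dot e u *: t).
    rewrite memv_cap mem_perp memvD ?memvZ //= dotDr !dotZr.
    by apply/eqP; rewrite mulrC; lra.
  by split; [|apply/positive_map]; apply: positiveD.
move=> [sK [u]]; rewrite memv_cap mem_perp => /andP[uL /eqP eu] [uG us].
split; apply/cell_complexP; split=> //.
  have [a [a0 uaL uaG uas]] := cell_complex_perturb uL wL uG us.
  exists (u + a *: w); rewrite //= uaG dotDr dotZr eu.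
  by rewrite add0r mulr_gt0.
have wL' : - w \in L by rewrite memvN.
have [a [a0 uaL uaG uas]] := cell_complex_perturb uL wL' uG us.
exists (u + a *: - w); rewrite //= uaG dotDr dotZr dotNr !dotNl eu.
by rewrite oppr0 add0r opprK mulr_gt0.
Qed.

(** Vertices of these colours never lie strictly on the positive side of a normal in [L]. *)
Definition colours_perp L : {set I} :=
  [set i in J | [forall v, (col v == i) ==> (L <= perp (f v))%VS]]%SET.

Hypothesis centered_colours : forall u v, col v \in J -> dot (f v) u != 0 ->
  exists2 w, col w = col v & 0 < dot (f w) u.
Hypothesis colours_perp_small : forall L, (0 < \dim L)%N ->
  (#|colours_perp L| + \dim L <= d)%N.

(** Signs do not vary over the cone, so the complex is the join on the positive vertices. By
    centering, every colour of [J] outside [colours_perp L] has a positive vertex, and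
    [colours_perp_small] bounds the number of colours lost. *)
Lemma acyclic_constant_sign L G u : u \in L -> u != 0 -> positive G u ->
  (forall v, [\/ (L <= perp (f v))%VS,
    forall u, u \in L -> positive G u -> 0 < dot (f v) u
    | forall u, u \in L -> positive G u -> dot (f v) u < 0]) ->
  acyclic_lt (cell_complex L G) (#|J| + \dim L - d).
Proof.
move=> uL u0 uG sgn.
pose P := [set v in col @^-1: J | 0 < dot (f v) u]%SET.
have -> : cell_complex L G = rainbow col P.
  apply/setP => s; apply/cell_complexP/rainbowP => [[/rainbowP[sQ sI]]|[sP sI]].
    move=> [t tL [tG ts]]; split=> //; apply/fintype.subsetP => v vs.
    rewrite inE (fintype.subsetP sQ) //=; have tv := ts _ vs.
    case: (sgn v) => [/subvP/(_ t tL)|/(_ u uL uG)|/(_ t tL tG)] //.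
      by rewrite mem_perp => /eqP; lra.
    by lra.
  split; last by exists u => //; split=> // v /(fintype.subsetP sP); rewrite inE => /andP[].
  apply/rainbowP; split=> //; apply: fintype.subset_trans sP _.
  by apply/fintype.subsetP => v; rewrite inE => /andP[].
apply: acyclic_lt_leq (@acyclic_rainbow _ _ col P).
have L0 : (0 < \dim L)%N.
  by rewrite lt0n dimv_eq0; apply: contraNneq u0 => L0; move: uL; rewrite L0 memv0.
have JP : J :\: colours_perp L \subset col @: P.
  apply/fintype.subsetP => i /finset.setDP[iJ]; rewrite inE iJ /= negb_forall => /existsP[v].
  rewrite negb_imply => /andP[/eqP vi /negP vL].
  have [||w wv wu] := @centered_colours u v; first by rewrite vi.
    by case: (sgn v) => // /(_ u uL uG); rewrite neq_lt => ->; rewrite ?orbT.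
  by apply/imsetP; exists w; rewrite ?wv // !inE wu wv vi iJ.
have := subset_leq_card JP; rewrite cardsD.
have : (#|J :&: colours_perp L| <= #|colours_perp L|)%N by apply/subset_leq_card/subsetIr.
by have := colours_perp_small L0; lia.
Qed.

(* Cutting the cone successively by the hyperplanes normal to the f v, v in r,
   reduces to cones on which every f v has constant sign. *)
Lemma acyclic_cell_complex_from r L G u : u \in L -> u != 0 -> G != [::] -> positive G u ->
  (forall v, v \notin r -> [\/ (L <= perp (f v))%VS,
    forall u, u \in L -> positive G u -> 0 < dot (f v) u
    | forall u, u \in L -> positive G u -> dot (f v) u < 0]) ->
  acyclic_lt (cell_complex L G) (#|J| + \dim L - d).
Proof.
elim: r L G u => [|v r IH] L G u uL u0 G0 uG sgn.
  by apply: (acyclic_constant_sign uL u0 uG) => v; apply: sgn.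
have skip : [\/ (L <= perp (f v))%VS,
    forall u, u \in L -> positive G u -> 0 < dot (f v) u
    | forall u, u \in L -> positive G u -> dot (f v) u < 0] ->
    acyclic_lt (cell_complex L G) (#|J| + \dim L - d).
  move=> vsgn; apply: (IH L G u) => // w wr.
  by have [->|wv] := eqVneq w v; [|apply: sgn; rewrite inE negb_or wv].
have [Lv|Lv] := boolP (L <= perp (f v))%VS; first by apply: skip; constructor 1.
have [w wL vw] := not_sub_perp Lv.
have wL' : - w \in L by rewrite memvN.
have [[p [pL pG vp]]|np] :=
    pselect (exists p, [/\ p \in L, positive G p & 0 < dot (f v) p]); last first.
  (* If [f v] were orthogonal to a normal in the cone, a tilt along [w] would make the product
     positive; so it is negative throughout. *)
  apply: skip; constructor 3 => t tL tG.
  have [//|vt|vt] := ltgtP (dot (f v) t) 0; first by case: np; exists t.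
  have [a a0 aG] := positive_perturb w tG; case: np; exists (t + a *: w).
  by rewrite memvD ?memvZ // dotDr dotZr vt add0r mulr_gt0.
have [[q [qL qG vq]]|nq] :=
    pselect (exists q, [/\ q \in L, positive G q & dot (f v) q < 0]); last first.
  apply: skip; constructor 2 => t tL tG.
  have [vt|//|vt] := ltgtP (dot (f v) t) 0; first by case: nq; exists t.
  have [a a0 aG] := positive_perturb (- w) tG; case: nq; exists (t + a *: - w).
  rewrite memvD ?memvZ // dotDr dotZr vt add0r dotNr mulrN.
  by rewrite oppr_lt0 mulr_gt0.
have positive_neq0 t : positive G t -> t != 0.
  by case: (G) G0 => //= g G' _ /andP[gt _]; apply: contraTneq gt => ->; rewrite dot0r ltxx.
have sub_sgn L' G' : (L' <= L)%VS ->
    (forall t, t \in L' -> positive G' t -> positive G t) ->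
    forall t, t != v -> t \notin r -> [\/ (L' <= perp (f t))%VS,
    forall u, u \in L' -> positive G' u -> 0 < dot (f t) u
    | forall u, u \in L' -> positive G' u -> dot (f t) u < 0].
  move=> L'L G'G t tv tr; have [|Lt|Lt|Lt] := sgn t; first by rewrite inE negb_or tv.
  - by constructor 1; apply: subv_trans L'L Lt.
  - by constructor 2 => x xL xG; apply: Lt; [apply: subvP xL|apply: G'G].
  - by constructor 3 => x xL xG; apply: Lt; [apply: subvP xL|apply: G'G].
rewrite (cell_complexU G Lv); apply: acyclic_ltU; try exact: cell_complex_down_closed.
- apply: (IH L _ p) => //; [exact: positive_neq0|by rewrite /= vp|].
  move=> t tr; have [->|tv] := eqVneq t v; last by apply: sub_sgn => // x _ /andP[].
  by constructor 2 => x _ /andP[].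
- apply: (IH L _ q) => //; [exact: positive_neq0|by rewrite /= dotNl oppr_gt0 vq|].
  move=> t tr; have [->|tv] := eqVneq t v; last by apply: sub_sgn => // x _ /andP[].
  by constructor 3 => x _ /andP[]; rewrite dotNl oppr_gt0.
- rewrite (cell_complexI G Lv).
  (* The section loses at most one dimension, matching the [m.-1] that [acyclic_ltU] asks of an
     intersection. *)
  apply: (@acyclic_lt_leq _ _ (#|J| + \dim (L :&: perp (f v)) - d)).
    have drop (a b c n : nat) : (b <= c.+1 -> (a + b - n).-1 <= a + c - n)%N by clear; lia.
    by apply: drop; apply: dim_cap_perp.
  have pqG : positive G (- dot (f v) q *: p + dot (f v) p *: q).
    by apply: positiveD; rewrite ?oppr_gt0.
  apply: (IH _ _ (- dot (f v) q *: p + dot (f v) p *: q)) => //.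
  + rewrite memv_cap mem_perp memvD ?memvZ //= dotDr !dotZr.
    by apply/eqP; rewrite mulrC; lra.
  + exact: positive_neq0.
  + move=> t tr; have [->|tv] := eqVneq t v; first by constructor 1; apply: capvSr.
    by apply: sub_sgn; rewrite ?capvSl.
Qed.

Lemma acyclic_cell_complex L G u : u \in L -> u != 0 -> G != [::] -> positive G u ->
  acyclic_lt (cell_complex L G) (#|J| + \dim L - d).
Proof.
move=> uL u0 G0 uG; apply: (acyclic_cell_complex_from (r := enum V) uL u0 G0 uG) => v.
by rewrite mem_enum.
Qed.

(** Cutting by the hyperplane orthogonal to some [e] in [L] drops the dimension by exactly one, and
    the two half-cones contain [e] and [- e]. Both halves are acyclic, so gluing raises the class of
    the section by one degree. *)
Lemma homology_line_cell_complex L : #|J| = d.+1 ->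
  homology_line (cell_complex L [::]) (\dim L).
Proof.
move=> Jd; have [k Lk] : {k | \dim L = k} by exists (\dim L).
elim: k L Lk => [|k IH] L Lk; rewrite Lk.
  have -> : cell_complex L [::] = [set finset.set0]%SET; last exact: homology_line_empty.
  have /eqP L0 : L == 0%VS by rewrite -dimv_eq0 Lk.
  apply/setP => s; rewrite !inE /=; apply/idP/eqP.
    move=> /andP[_ /asboolP[u]]; rewrite L0 memv0 => /eqP -> [_ s0].
    by apply/setP => v; rewrite inE; apply/negP => /s0; rewrite dot0r ltxx.
  move=> ->; rewrite finset.sub0set imset0 !cards0 eqxx /=; apply/asboolP.
  by exists 0; [exact: mem0v|split=> // v; rewrite inE].
pose e := vpick L.
have eL : e \in L by exact: memv_pick.
have e0 : e != 0 by rewrite vpick0 -dimv_eq0 Lk.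
have ee : 0 < dot e e by rewrite dot_self_gt0.
have Le : ~~ (L <= perp e)%VS.
  by apply/negP => /subvP/(_ e eL); rewrite mem_perp => /eqP; lra.
have L'k : \dim (L :&: perp e) = k.
  by apply/eqP; rewrite -eqSS -(dim_cap_perp_self eL e0) Lk.
(* One colour more than [d] makes each half acyclic just as far as [homology_lineU] demands. *)
have bound : (#|J| + \dim L - d)%N = k.+2 by rewrite Jd Lk; lia.
rewrite (cell_complexU _ Le); apply: homology_lineU; try exact: cell_complex_down_closed.
- by rewrite -bound; apply: (@acyclic_cell_complex _ _ e); rewrite //= ee.
- rewrite -bound; apply: (@acyclic_cell_complex _ _ (- e)); rewrite ?memvN ?oppr_eq0 //=.
  by rewrite dotNl dotNr opprK ee.
- by rewrite (cell_complexI _ Le) -[X in homology_line _ X]L'k; apply: IH.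
Qed.

End Cells.

(** * Change of coordinates and induction on the dimension *)

Lemma dot_mulmx (R : realFieldType) (m d : nat) (B : 'M[R]_(m, d)) x u :
  dot (x *m B) u = dot x (u *m B^T).
Proof. by rewrite /dot trmx_mul mulmxA. Qed.

(** [B] turns points of [W] into a configuration in dimension [\dim W]; as [C] recovers them, a
    normal [u] is transported to [u *m C^T]. *)
Lemma vspace_coordinates (R : realFieldType) (d : nat) (W : {vspace 'rV[R]_d}) :
  exists (B : 'M[R]_(d, \dim W)) (C : 'M[R]_(\dim W, d)),
    forall x, x \in W -> x *m B *m C = x.
Proof.
pose C := \matrix_(i < \dim W) (vbasis W)`_i.
exists (pinvmx C), C => x /coord_vbasis xE; apply: mulmxKpV; rewrite xE.
apply: summx_sub => i _; apply: scalemx_sub.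
by rewrite -(rowK (fun i : 'I_(\dim W) => (vbasis W)`_i)) row_sub.
Qed.

Lemma subset_of_card (T : finType) (A : {set T}) n :
  (n <= #|A|)%N -> exists2 B : {set T}, B \subset A & #|B| = n.
Proof.
move=> /card_geqP[s [s_uniq sn sA]]; exists [set x in s]%SET.
  by apply/fintype.subsetP => x; rewrite inE => /sA.
by rewrite cardsE (card_uniqP s_uniq).
Qed.

(* The dimension count on which the cutting argument rests is itself obtained
   from the conclusion in smaller dimension: more than \dim W colours contained
   in W would give \dim W + 1 of them none of whose rainbow simplices captures
   the origin, hence a join of discrete sets, which is too highly connected. *)
Lemma homology_line_centered (R : realFieldType) (d : nat) (V I : finType)
    (col : V -> I) (J : {set I}) (f : V -> 'rV[R]_d) :
  #|J| = d.+1 ->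
  (forall i, i \in J -> exists v, col v = i) ->
  (forall u v, col v \in J -> dot (f v) u != 0 ->
    exists2 w, col w = col v & 0 < dot (f w) u) ->
  (forall s, s \in rainbow col (col @^-1: J) -> (#|s| <= d)%N ->
    exists u, forall v, v \in s -> 0 < dot (f v) u) ->
  homology_line (cell_complex col J f fullv [::]) d.
Proof.
have [k] := ubnP d; elim: k d J f => // k IH d J f /ltnSE dk Jd nonempty centr gen.
have dimE : \dim (fullv : {vspace 'rV[R]_d}) = d by rewrite dimvf /dim /= mul1n.
rewrite -[X in homology_line _ X]dimE.
apply: homology_line_cell_complex => // L L0; rewrite leqNgt; apply/negP => Kbig.
set K := colours_perp _ _ _ _ in Kbig.
pose W := <<[seq f v | v <- enum V & col v \in K]>>%VS.
have fW v : col v \in K -> f v \in W.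
  by move=> vK; apply/memv_span/map_f; rewrite mem_filter vK mem_enum.
(* [W] is orthogonal to [L], so a common vector is orthogonal to itself. *)
have WL : (W :&: L = 0)%VS.
  apply/eqP; rewrite -subv0; apply/subvP => x; rewrite memv_cap memv0 => /andP[xW xL].
  suff : x \in perp x.
    rewrite mem_perp => /eqP xx.
    by have := dot_self_gt0 x; rewrite xx ltxx => /esym/negbFE.
  apply: subvP xW; apply/span_subvP => _ /mapP[v + ->].
  rewrite mem_filter inE => /andP[/andP[_ /forallP/(_ v)]] + _.
  by rewrite eqxx /= => /subvP/(_ x xL); rewrite !mem_perp dotC.
have WLd : (\dim W + \dim L <= d)%N.
  by rewrite -dimv_disjoint_sum // -[X in (_ <= X)%N]dimE dimvS ?subvf.
have [B [C BC]] := vspace_coordinates W.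
(* The induction hypothesis in dimension [\dim W] takes exactly this many colours; [Kbig] and [WLd]
   supply them. *)
have [K' K'K K'W] := @subset_of_card _ K (\dim W).+1 ltac:(lia).
have KJ : K \subset J by apply/fintype.subsetP => i; rewrite inE => /andP[].
have K'J i : i \in K' -> i \in J by move=> /(fintype.subsetP K'K)/(fintype.subsetP KJ).
have gen' s : s \in rainbow col (col @^-1: K') ->
    exists u, forall v, v \in s -> 0 < dot (f v *m B) u.
  move=> /rainbowP[sK' sI].
  (* As [L] is nonzero, [\dim W < d], so even a simplex using all colours of [K'] is small enough
     for general position. *)
  have sd : (#|s| <= d)%N.
    rewrite -(card_in_imset sI); apply: (@leq_trans #|K'|); last by lia.
    apply/subset_leq_card/fintype.subsetP => _ /imsetP[v vs ->].
    by have := fintype.subsetP sK' v vs; rewrite inE.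
  have [|u us] := gen s _ sd.
    apply/rainbowP; split=> //; apply/fintype.subsetP => v vs; rewrite inE.
    by apply: K'J; have := fintype.subsetP sK' v vs; rewrite inE.
  exists (u *m C^T) => v vs; rewrite -dot_mulmx BC ?us //; apply: fW.
  by have := fintype.subsetP sK' v vs; rewrite inE => /(fintype.subsetP K'K).
have /homology_line_not_acyclic : homology_line
    (cell_complex col K' (fun v => f v *m B) fullv [::]) (\dim W).
  apply: IH => //.
  - by apply: leq_trans dk; apply: leq_trans WLd; rewrite -addn1 leq_add2l.
  - by move=> i /K'J; apply: nonempty.
  - move=> u v /K'J vJ; rewrite dot_mulmx => /(centr _ _ vJ)[w wv wu].
    by exists w; rewrite // dot_mulmx.
  - by move=> s /gen'.
apply; have -> : cell_complex col K' (fun v => f v *m B) fullv [::] =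
    rainbow col (col @^-1: K').
  apply/setP => s; apply/cell_complexP/idP => [[]|sK'] //; split=> //.
  by have [u us] := gen' s sK'; exists u; rewrite ?memvf.
have := @acyclic_rainbow _ _ col (col @^-1: K').
apply: acyclic_lt_leq; rewrite -K'W; apply/subset_leq_card/fintype.subsetP => i iK'.
have [v vi] := nonempty i (K'J i iK').
by apply/imsetP; exists v; rewrite // inE vi.
Qed.

(** * Convex hulls and half-spaces *)

(** Induction removing a vector [v0]. Weights for the rest extend by 0. A solution [u] for the rest,
    or a small tilt of it, serves [v0] too unless [f v0] is 0 or has negative product with [u]; in
    the latter case the rest is projected along [f v0] onto the hyperplane orthogonal to [u]. *)
Lemma gordan (R : realFieldType) (d : nat) (V : finType) (s : {set V}) (f : V -> 'rV[R]_d) :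
  (exists u, forall v, v \in s -> 0 < dot (f v) u) \/
  (exists w : V -> R, [/\ forall v, v \in s -> 0 <= w v, 0 < \sum_(v in s) w v
    & \sum_(v in s) w v *: f v = 0]).
Proof.
have [k] := ubnP #|s|; elim: k s f => // k IH s f /ltnSE sk.
have [->|[v0 v0s]] := set_0Vmem s; first by left; exists 0 => v; rewrite inE.
pose s' := (s :\ v0)%SET.
have s'k : (#|s'| < k)%N by move: sk; rewrite (cardsD1 v0 s) v0s.
have s'P v : v \in s -> v = v0 \/ v \in s'.
  by move=> vs; rewrite !inE vs andbT; case: eqP; [left|right].
have extend (w : V -> R) (c : R) : (forall v, v \in s' -> 0 <= w v) -> 0 <= c ->
    0 < c + \sum_(v in s') w v -> c *: f v0 + \sum_(v in s') w v *: f v = 0 ->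
    exists w : V -> R, [/\ forall v, v \in s -> 0 <= w v, 0 < \sum_(v in s) w v
    & \sum_(v in s) w v *: f v = 0].
  move=> w0 c0 cw cf; exists (fun v => if v == v0 then c else w v).
  have s'0 v : v \in s' -> (v == v0) = false by rewrite !inE => /andP[/negPf].
  split.
  - by move=> v /s'P[->|vs]; rewrite ?eqxx // s'0 // w0.
  - rewrite (finset.big_setD1 v0) //= eqxx; apply: lt_le_trans cw _.
    by rewrite lerD2l; apply: ler_sum => v /s'0 ->.
  - rewrite (finset.big_setD1 v0) //= eqxx -[RHS]cf; congr (_ + _).
    by apply: eq_bigr => v /s'0 ->.
have [[u us]|[w [w0 w1 wf]]] := IH s' f s'k; last first.
  by right; apply: (extend w 0); rewrite ?add0r ?scale0r ?add0r.
have [au|au|au] := ltgtP (dot (f v0) u) 0; last 2 first.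
- by left; exists u => v /s'P[->|/us].
- have [a0|a0] := eqVneq (f v0) 0.
    right; apply: (extend (fun=> 0) 1) => //.
      by rewrite big1 ?addr0.
    by rewrite a0 scaler0 add0r big1 // => v _; rewrite scale0r.
  have [|e e0 es] := @small_perturbation R V (enum s') (fun v => dot (f v) u)
      (fun v => dot (f v) (f v0)).
    by move=> v; rewrite mem_enum; apply: us.
  left; exists (u + e *: f v0) => v /s'P[->|vs]; rewrite dotDr dotZr.
    by rewrite au add0r mulr_gt0 // dot_self_gt0.
  by apply: es; rewrite mem_enum.
(* These are nonnegative on [s'], so weights for the projected vectors convert to weights for the
   original ones and [f v0]. *)
pose c v := - dot (f v) u / dot (f v0) u.
have cu v : c v * dot (f v0) u = - dot (f v) u by rewrite divfK // lt_eqF.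
have c0 v : v \in s' -> 0 <= c v.
  by move=> /us vu; rewrite ltW // /c mulNr -mulrN -invrN divr_gt0 // oppr_gt0.
(* The vectors f v + c v *: f v0 are orthogonal to u, so a multiple of u may be
   added to a solution t for them in order to adjust dot (f v0) t. *)
have [[t ts]|[w [w0 w1 wf]]] := IH s' (fun v => f v + c v *: f v0) s'k; last first.
  right; apply: (extend w (\sum_(v in s') w v * c v)) => //.
  - by apply: sumr_ge0 => v vs; rewrite mulr_ge0 ?w0 ?c0.
  - by rewrite ltr_wpDl //; apply: sumr_ge0 => v vs; rewrite mulr_ge0 ?w0 ?c0.
  - rewrite -[RHS]wf scaler_suml -big_split; apply: eq_bigr => v _ /=.
    by rewrite scalerDr scalerA addrC.
have [|e e0 es] := @small_perturbation R V (enum s')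
    (fun v => dot (f v + c v *: f v0) t) (fun v => - c v).
  by move=> v; rewrite mem_enum; apply: ts.
(* The product with [f v0] becomes [e]; for [v] in [s'] it becomes that of [t] with the projected
   vector, minus [c v * e], positive by the choice of [e]. *)
left; exists (t + (e - dot (f v0) t) / dot (f v0) u *: u) => v.
rewrite dotDr dotZr => /s'P[->|vs]; first by rewrite divfK ?lt_eqF //; lra.
have := es v; rewrite mem_enum dotDl dotZl => /(_ vs).
suff -> : (e - dot (f v0) t) / dot (f v0) u * dot (f v) u =
    - c v * (e - dot (f v0) t) by lra.
by rewrite /c; ring.
Qed.

Section Convexity.
Variables (R : realType) (d : nat) (V : finType) (f : V -> 'rV[R]_d).
Implicit Types (s : {set V}) (u : 'rV[R]_d).

Lemma conv_dot (A : set 'rV[R]_d) x u :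
  Defs.conv A x -> (forall y, A y -> dot y u <= 0) -> dot x u <= 0.
Proof.
move=> [m [w [a [Aa w0 w1 ->]]]] Au; rewrite dot_suml; apply: sumr_le0 => j _.
by rewrite dotZl mulr_ge0_le0 // Au.
Qed.

(** Gordan's weights divided by their sum are convex coefficients; conversely, a convex combination
    of points with positive products with [u] cannot vanish. *)
Lemma conv_image0P s :
  conv_image f s 0 <-> ~ exists u, forall v, v \in s -> 0 < dot (f v) u.
Proof.
split=> [[m [w [a [Aa w0 w1 wa]]]] [u us]|sep].
  have au j : 0 < dot (a j) u by have [v vs <-] := Aa j; apply: us.
  have wau0 j : 0 <= w j * dot (a j) u by rewrite mulr_ge0 // ltW.
  have : \sum_j w j * dot (a j) u = 0.
    by under eq_bigr do rewrite -dotZl; rewrite -dot_suml -wa dot0l.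
  move=> /(psumr_eq0P (fun j _ => wau0 j)) wau.
  move: w1; rewrite big1 => [/esym/eqP|j _]; first by rewrite oner_eq0.
  by have /eqP := wau j isT; rewrite mulf_eq0 (gt_eqF (au j)) orbF => /eqP.
have [//|[w [w0 w1 wf]]] := gordan s f; pose S := \sum_(v in s) w v.
exists #|s|, (fun j => w (enum_val j) / S), (fun j => f (enum_val j)); split.
- by move=> j; exists (enum_val j) => //; apply: enum_valP.
- by move=> j; rewrite divr_ge0 ?(ltW w1) // w0 // enum_valP.
- by rewrite -mulr_suml -(big_enum_val w) divff // gt_eqF.
- under eq_bigr do rewrite mulrC -scalerA.
  by rewrite -scaler_sumr -(big_enum_val (fun v => w v *: f v)) wf scaler0.
Qed.

(** If all products with [u] were nonpositive, that of [f v] would be negative. Relative interiority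
    of 0 puts a small [- t *: f v] in the hull, with positive product. *)
Lemma relint_conv_image s u v : relint (conv_image f s) 0 -> v \in s ->
  dot (f v) u != 0 -> exists2 w, w \in s & 0 < dot (f w) u.
Proof.
move=> [A0 near0] vs; rewrite neq_lt => /orP[vu|vu]; last by exists v.
have [//|nw] := pselect (exists2 w, w \in s & 0 < dot (f w) u).
have us w : w \in s -> dot (f w) u <= 0.
  by move=> ws; rewrite leNgt; apply/negP => wu; apply: nw; exists w.
have [e /= e0 ball_e] : nbhs_ball (0 : 'rV[R]_d)
    [set y | aff (conv_image f s) y -> conv_image f s y]%classic by exact/nbhs_ballP.
(* Chosen so that every coordinate of [t *: f v] is below [e] in absolute value. *)
have [|t t0 te] := @small_perturbation R 'I_d (enum 'I_d) (fun=> e) (fun j => - `|f v 0 j|).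
  by [].
have fv : conv_image f s (f v).
  exists 1%N, (fun=> 1), (fun=> f v); split.
  - by move=> _; exists v.
  - by move=> _; apply: ler01.
  - by rewrite big_ord1.
  - by rewrite big_ord1 scale1r.
have : conv_image f s (- t *: f v).
  apply: ball_e.
    split=> // i j; rewrite ord1 !mxE -ball_normE /= sub0r mulNr opprK normrM (gtr0_norm t0).
    by have := te j; rewrite mem_enum => /(_ isT); lra.
  (* An affine combination of 0 and [f v], both in the hull. *)
  exists 2%N, (fun j => if j == ord0 then 1 + t else - t), (fun j => if j == ord0 then 0 else f v).
  split.
  - by move=> j; case: ifP.
  - by rewrite !big_ord_recl big_ord0 /= addr0 addrK.
  - by rewrite !big_ord_recl big_ord0 /= scaler0 addr0 add0r.
move=> tfv; have : dot (- t *: f v) u <= 0.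
  by apply: (conv_dot tfv) => _ [w ws <-]; apply: us.
by rewrite dotZl; nra.
Qed.

End Convexity.

(** * Homology of the avoiding complex *)

Theorem theorem2p3 (R : realType) (d : nat) (n : 'I_d.+1 -> nat)
    (V : finType) (D : 'I_d.+1 -> {set V}) (f : V -> 'rV[R]_d)
    (disjD : forall i j, i != j -> [disjoint D i & D j])
    (coverD : forall v, exists i, v \in D i)
    (cardD : forall i, #|D i| = n i)
    (n_ge2 : forall i, (2 <= n i)%N)
    (f_centered : centered D f)
    (f_general : relative_general_position D f) :
  reduced_betti (avoiding D f) (d%:Z - 1) = 1%N.
Proof.
pose col v := xchoose (coverD v).
have colD v i : (v \in D i) = (col v == i).
  apply/idP/eqP => [vi|<-]; last exact: (xchooseP (coverD v)).
  apply/eqP/negPn/negP => /disjD/disjoint_setI0/setP/(_ v).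
  by rewrite !inE vi (xchooseP (coverD v)).
have DeltaE s : (s \in Delta D) = (s \in rainbow col (col @^-1: [set: 'I_d.+1]%SET)).
  rewrite inE; apply/forallP/rainbowP => [sD|[_ sI] i].
    split; first by apply/fintype.subsetP => v; rewrite !inE.
    move=> x y xs ys xy; apply: (card_le1_eqP (sD (col x))); rewrite !inE colD ?xs ?ys ?eqxx //.
    by rewrite xy eqxx.
  apply/card_le1_eqP => x y; rewrite !inE !colD => /andP[xs /eqP xi] /andP[ys /eqP yi].
  by apply: sI; rewrite // xi yi.
(* With the whole space for [L] and no constraint in [G], every normal is allowed, so [conv_image0P]
   identifies the two complexes. *)
have avoidingE : avoiding D f = cell_complex col [set: 'I_d.+1]%SET f fullv [::].
  apply/setP => s; rewrite inE DeltaE; apply/andP/cell_complexP => -[sD].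
    move=> /asboolP s0; split=> //.
    have [u us] : exists u, forall v, v \in s -> 0 < dot (f v) u.
      by apply: contrapT => /conv_image0P.
    by exists u; rewrite ?memvf.
  move=> [u _ [_ us]]; split=> //; apply/asboolP => /conv_image0P; apply.
  by exists u.
apply: homology_line_betti; first exact: avoiding_down_closed.
rewrite avoidingE; apply: homology_line_centered.
- by rewrite cardsT card_ord.
- move=> i _; have /card_gt0P[v] : (0 < #|D i|)%N by rewrite cardD ltnW.
  by rewrite colD => /eqP; exists v.
- move=> u v _ vu; have [|w] := relint_conv_image (f_centered (col v)) _ vu.
    by rewrite colD.
  by rewrite colD => /eqP; exists w.
- move=> s; rewrite -DeltaE => sD sd; apply: contrapT => /conv_image0P.
  exact: f_general.
Qed.
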